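(* Let $k$ be a positive integer and let $A=\{a_1,\ldots,a_{2k}\}\subset\mathbb F_q$ be a set of $2k$ distinct elements with $a_1+\cdots+a_{2k}=0$. Assume that $\eta(\pi_A(a))$ is the same for all $a\in A$. Then: (1) if $A$ is $k$-zero-sum free, then there exists $\lambda=(\lambda_1,\ldots,\lambda_{2k})$ with all $\lambda_i\in\mathbb F_q^*$ such that $\mathcal C(A,k,\lambda)$ is a $q$-ary MDS self-dual code; (2) if $A$ contains a zero-sum subset of size $k$, then there exists $\lambda=(\lambda_1,\ldots,\lambda_{2k})$ with all $\lambda_i\in\mathbb F_q^*$ such that $\mathcal C(A,k,\lambda)$ is a $q$-ary NMDS self-dual code.
   Context: $\mathbb F_q$ is the finite field with $q$ elements, $\mathbb F_q^*=\mathbb F_q\setminus\{0\}$, and $\eta$ is the quadratic character of $\mathbb F_q^*$ ($\eta(x)=1$ if $x$ is a nonzero square in $\mathbb F_q$, and $\eta(x)=-1$ if $x$ is a non-square). For $A\subset\mathbb F_q$ and $a\in A$, $\pi_A(a)=\prod_{e\in A,\ e\neq a}(a-e)$. A $q$-ary $[n,k,d]$-linear code is a subspace $\mathcal C$ of $\mathbb F_q^n$ of dimension $k$ and minimum (Hamming) distance $d$. Its dual is $\mathcal C^{\bot}=\{b\in\mathbb F_q^n : \sum_{i=1}^n a_ib_i=0 \text{ for all } a\in\mathcal C\}$; $\mathcal C$ is self-dual if $\mathcal C=\mathcal C^{\bot}$. An $[n,k,d]$-linear code is MDS if $d=n-k+1$ and AMDS if $d=n-k$. An AMDS code $\mathcal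 C$ is NMDS if $\mathcal C^{\bot}$ is also AMDS. The code $\mathcal C(A,k,\lambda)$: for positive integers $n>k$, a set $A=\{a_1,\ldots,a_n\}\subset\mathbb F_q$ of $n$ distinct elements, and $\lambda=(\lambda_1,\ldots,\lambda_n)$ with all $\lambda_i\in\mathbb F_q^*$, $\mathcal C(A,k,\lambda)$ is the $q$-ary linear code of length $n$ generated by the $k$ rows $(\lambda_1a_1^j,\lambda_2a_2^j,\ldots,\lambda_na_n^j)$ with exponents $j=k,\,k-2,\,k-3,\ldots,1,0$ (i.e. $j\in\{k\}\cup\{0,1,\ldots,k-2\}$; the exponent $k-1$ is omitted; $a^0=1$ for every $a\in\mathbb F_q$). Here it is used with $n=2k$. A finite subset of $\mathbb F_q$ is zero-sum if the sum of its elements is $0$. The set $A$ is $k$-zero-sum free if $A$ contains no zero-sum subset of size $k$. *)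

(* Defs.v *)
From HB Require Import structures.
From mathcomp Require Import all_boot all_order all_algebra.

Set Implicit Arguments.
Unset Strict Implicit.
Unset Printing Implicit Defensive.

Import GRing.Theory.
Local Open Scope ring_scope.

(* In characteristic 2 every nonzero element is a square, so the value is 1
   off 0.  The value at 0 is a convention, and is irrelevant at
   [pi_set A a], which never vanishes. *)
Definition quad_char (F : finFieldType) (x : F) : int :=
  if x == 0 then 0 else if [exists y : F, y ^+ 2 == x] then 1 else -1.

Definition pi_set (F : finFieldType) (A : {set F}) (a : F) : F :=
  \prod_(e in A | e != a) (a - e).

Definition zero_sum (F : finFieldType) (S : {set F}) : Prop :=
  \sum_(x in S) x = 0.

Definition zero_sum_free (F : finFieldType) (k : nat) (A : {set F}) : Prop :=
  forall S : {set F}, S \subset A -> #|S| = k -> ~ zero_sum S.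

Section Codes.
Variables (F : finFieldType) (n : nat).
Implicit Types (C : {vspace 'rV[F]_n}) (u v : 'rV[F]_n).

Definition hamming_dist u v : nat := #|[set i : 'I_n | u 0 i != v 0 i]|.

(* A relation rather than a function, since the zero code has no
   minimum distance. *)
Definition min_dist C (d : nat) : Prop :=
  (exists u v, [/\ u \in C, v \in C, u != v & hamming_dist u v = d]) /\
  (forall u v, u \in C -> v \in C -> u != v -> (d <= hamming_dist u v)%N).

Definition linear_code C (k d : nat) : Prop := \dim C = k /\ min_dist C d.

Definition dual_code C : {vspace 'rV[F]_n} :=
  (\bigcap_(u : 'rV[F]_n | u \in C) lker (linfun (mulmxr u^T)))%VS.

Lemma dual_codeP C v :
  reflect (forall u, u \in C -> \sum_(i < n) u 0 i * v 0 i = 0)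
          (v \in dual_code C).
Proof.
have kerE u : (v \in lker (linfun (mulmxr u^T))) =
              (\sum_(i < n) u 0 i * v 0 i == 0).
  rewrite memv_ker lfunE /=.
  have -> : v *m u^T = (\sum_(i < n) u 0 i * v 0 i)%:M.
    apply/matrixP=> r s; rewrite !ord1 !mxE eqxx mulr1n.
    by apply: eq_bigr => i _; rewrite !mxE mulrC.
  apply/eqP/eqP => [/matrixP/(_ 0 0)|->]; last by rewrite raddf0.
  by rewrite !mxE mulr1n.
rewrite memvE; apply: (iffP subv_bigcapP) => vC u Cu.
  by apply/eqP; rewrite -kerE memvE vC.
by rewrite -memvE kerE vC.
Qed.

Definition self_dual C : Prop := C = dual_code C.

Definition MDS C : Prop :=
  exists k d, linear_code C k d /\ d = (n - k + 1)%N.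

Definition AMDS C : Prop :=
  exists k d, linear_code C k d /\ d = (n - k)%N.

Definition NMDS C : Prop := AMDS C /\ AMDS (dual_code C).

(* For 0 < k the exponents are k and 0, ..., k - 2: k - 1 is omitted. *)
Definition code_gen (a : 'I_n -> F) (k : nat) (lambda : 'I_n -> F) :
    {vspace 'rV[F]_n} :=
  <<[seq \row_(i < n) (lambda i * a i ^+ j) | j <- k :: iota 0 k.-1]>>%VS.

End Codes.

(* Main.v *)
(* Since all pi_A(a_i) lie in one square class, lambda_i^2 = c / pi_A(a_i) can
   be solved for a common constant c.  Codewords are then the evaluations
   lambda_i f(a_i) of polynomials f of degree <= k without term X^(k-1).  By
   Lagrange interpolation, sum_i h(a_i) / pi_A(a_i) is the coefficient of
   X^(2k-1) in h when deg h < 2k, and this persists up to degree 2k because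
   sum_i a_i = 0.  For a product h = f g of two such polynomials this
   coefficient vanishes, so the code is self-orthogonal of dimension k, hence
   self-dual.  A nonzero f has at most k roots in A, with exactly k of them if
   and only if, up to a scalar, f = prod_(s in S) (X - s) for a zero-sum subset
   S of size k.  This gives minimum distance k if there is such an S, and k + 1
   otherwise. *)
Require Import Defs.
From HB Require Import structures.
From mathcomp Require Import all_boot all_order all_algebra.
From mathcomp Require Import all_solvable all_field zify.

Set Implicit Arguments.
Unset Strict Implicit.
Unset Printing Implicit Defensive.

Import GRing.Theory.
Local Open Scope ring_scope.

(** * Square classes in a finite field *)

Section QuadraticCharacter.
Variable F : finFieldType.
Implicit Types x y : F.

Lemma expf_card_pred x : x != 0 -> x ^+ #|F|.-1 = 1.
Proof.
move=> x0; apply: (mulfI x0); rewrite mulr1 -exprS.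
by rewrite (ltn_predK (finNzRing_gt1 F)) expf_card.
Qed.

Lemma finField_prim_root : exists z : F, #|F|.-1.-primitive_root z.
Proof.
have : has (#|F|.-1).-primitive_root (enum (predC1 (0 : F))).
  apply: has_prim_root.
  - by rewrite -ltnS (ltn_predK (finNzRing_gt1 F)) finNzRing_gt1.
  - apply/allP => x; rewrite mem_enum => x0.
    by apply/unity_rootP; apply: expf_card_pred.
  - exact: enum_uniq.
  - by rewrite -cardE cardC1.
by case/hasP => z _; exists z.
Qed.

(** For two squares, divide their roots. Two non-squares are odd powers of a primitive element [g],
    so [x * y] is an even power of [g], and [x / y] is [x * y] divided by [y ^+ 2]. *)
Lemma quad_char_eq_div_sqr x y : x != 0 -> y != 0 ->
  quad_char x = quad_char y -> exists z, z ^+ 2 = x / y.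
Proof.
have [g gP] := finField_prim_root.
have powP u : u != 0 -> exists i, u = g ^+ i.
  by move/expf_card_pred/(prim_rootP gP) => [i ->]; exists i.
move=> x0 y0; rewrite /quad_char (negPf x0) (negPf y0).
case: existsP => [[s /eqP sx]|nx]; case: existsP => [[t /eqP ty]|ny] // _.
  by exists (s / t); rewrite expr_div_n sx ty.
have [i xE] := powP x x0; have [j yE] := powP y y0.
have oddP u m : u = g ^+ m -> ~ (exists s, s ^+ 2 == u) -> odd m.
  move=> uE nu; apply/negPn/negP => even_m; case: nu; exists (g ^+ m./2).
  by rewrite -exprM muln2 even_halfK // uE.
exists (g ^+ (i + j)./2 / y).
rewrite expr_div_n -exprM muln2 even_halfK; last first.
  by rewrite oddD (oddP _ _ xE nx) (oddP _ _ yE ny).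
by rewrite exprD -xE -yE expr2 -mulf_div divff ?mulr1.
Qed.

End QuadraticCharacter.

(** * Dimension of the dual code *)

Section Dual.
Variables (F : finFieldType) (n : nat).
Implicit Types C : {vspace 'rV[F]_n}.

(** Rank-nullity for right multiplication by the transpose of a generator matrix [M]: the kernel is
    the dual code, and the map is onto because the rows of [M] are free. *)
Lemma dim_dual_code C : \dim (dual_code C) = (n - \dim C)%N.
Proof.
pose M : 'M_(\dim C, n) := \matrix_i (vbasis C)`_i.
have mulM (u : 'rV_(\dim C)) : u *m M = \sum_i u 0 i *: (vbasis C)`_i.
  by rewrite mulmx_sum_row; apply: eq_bigr => i _; rewrite rowK.
have M_free : row_free M.
  apply: inj_row_free => u; rewrite mulM => u0.
  apply/rowP => i; rewrite mxE.
  by move/freeP: (basis_free (vbasisP C)) => /(_ (u 0)) ->.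
pose f : 'Hom('rV[F]_n, 'rV[F]_(\dim C)) := linfun (mulmxr M^T).
have kerf : lker f = dual_code C.
  apply/vspaceP => v; rewrite memv_ker lfunE /=; apply/eqP/dual_codeP.
    move=> vM u uC.
    transitivity ((v *m u^T) 0 0).
      by rewrite mxE; apply: eq_bigr => i _; rewrite !mxE mulrC.
    rewrite (coord_vbasis uC).
    have -> : \sum_i coord (vbasis C) i u *: (vbasis C)`_i
      = (\row_i coord (vbasis C) i u) *m M.
      by rewrite mulM; apply: eq_bigr => i _; rewrite mxE.
    by rewrite trmx_mul mulmxA vM mul0mx mxE.
  move=> vC; apply/rowP => i; rewrite !mxE.
  rewrite -[RHS](vC (vbasis C)`_i); last first.
    by rewrite vbasis_mem ?mem_nth // size_tuple.
  by apply: eq_bigr => j _; rewrite !mxE mulrC.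
(* [pinvmx M] is a right inverse of [M], so its transpose yields preimages under multiplication by
   [M^T]. *)
have imf : limg f = fullv.
  apply/eqP; rewrite eqEsubv subvf /=; apply/subvP => w _.
  apply/memv_imgP; exists (w *m (pinvmx M)^T); rewrite ?memvf // lfunE /=.
  by rewrite -mulmxA -trmx_mul mulmxVp // trmx1 mulmx1.
have := limg_ker_dim f fullv; rewrite capfv kerf imf !dimvf /dim /= !mul1n.
by move=> /(congr1 (subn^~ (\dim C))); rewrite addnK.
Qed.

Lemma self_dual_half C :
  (\dim C).*2 = n -> (C <= dual_code C)%VS -> self_dual C.
Proof.
move=> dimC sub; apply/eqP; rewrite eqEdim sub dim_dual_code.
rewrite -[X in (X - _)%N]dimC -addnn addnK.
exact: leqnn.
Qed.

End Dual.

(** * Lagrange interpolation sums *)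

Section LagrangeSums.
Variables (F : fieldType) (n : nat) (a : 'I_n -> F).
Hypothesis a_inj : injective a.
Implicit Types f g : {poly F}.

(** The indexed form of [pi_set], which is also the derivative at [a i] of the product of all
    ['X - (a j)%:P]. *)
Definition node_prod (i : 'I_n) : F := \prod_(j | j != i) (a i - a j).

Lemma node_prod_neq0 i : node_prod i != 0.
Proof.
apply/prodf_neq0 => j ji; rewrite subr_eq0.
by apply: contraNneq ji => /a_inj ->.
Qed.

(** The Lagrange basis polynomial before division by [node_prod i], hence monic. *)
Definition node_poly (i : 'I_n) : {poly F} :=
  \prod_(j | j != i) ('X - (a j)%:P).

Lemma horner_node_poly i j :
  (node_poly i).[a j] = if j == i then node_prod i else 0.
Proof.
rewrite horner_prod; case: eqVneq => [->|ji].
  by apply: eq_bigr => l _; rewrite !hornerE.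
by rewrite (bigD1 j) //= !hornerE subrr mul0r.
Qed.

Lemma node_polyE i :
  node_poly i = \prod_(j <- enum (predC1 i)) ('X - (a j)%:P).
Proof. by rewrite big_enum. Qed.

Lemma size_node_poly i : size (node_poly i) = n.
Proof.
rewrite node_polyE size_prod_XsubC -cardE cardC1 card_ord.
exact: ltn_predK (ltn_ord i).
Qed.

Lemma node_poly_coef i : (node_poly i)`_n.-1 = 1.
Proof.
have /monicP := monic_prod_XsubC (enum (predC1 i)) xpredT a.
by rewrite -node_polyE lead_coefE size_node_poly.
Qed.

Lemma poly_eq0_nodes f : (size f <= n)%N -> (forall i, f.[a i] = 0) -> f = 0.
Proof.
move=> szf f0; apply: (@roots_geq_poly_eq0 _ _ (codom a)).
- by apply/allP => _ /codomP[i ->]; rewrite rootE f0.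
- by apply/injectiveP.
- by rewrite size_codom card_ord.
Qed.

(** [f] equals its interpolant [g], since their difference has degree below [n] and vanishes at [n]
    nodes. Each [node_poly i] is monic of degree [n - 1], so comparing the coefficients of [X^(n-1)]
    gives the sum. *)
Lemma lagrange_lead f : (size f <= n)%N ->
  \sum_i f.[a i] / node_prod i = f`_n.-1.
Proof.
move=> szf; pose g := \sum_i (f.[a i] / node_prod i) *: node_poly i.
have szg : (size g <= n)%N.
  apply: (leq_trans (size_sum _ _ _)); apply/bigmax_leqP => i _.
  by rewrite (leq_trans (size_scale_leq _ _)) ?size_node_poly.
have fg : f - g = 0.
  apply: poly_eq0_nodes => [|j].
    by rewrite (leq_trans (size_polyD _ _)) // geq_max size_polyN szf.
  rewrite hornerD hornerN horner_sum (bigD1 j) //= big1 => [|i ij].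
    rewrite addr0 hornerZ horner_node_poly eqxx.
    by rewrite divfK ?node_prod_neq0 // subrr.
  by rewrite hornerZ horner_node_poly eq_sym (negPf ij) mulr0.
rewrite (subr0_eq fg) coef_sum; apply: eq_bigr => i _.
by rewrite coefZ node_poly_coef mulr1 -(subr0_eq fg).
Qed.

(** Subtracting a multiple of [P], which vanishes at every node, removes the term of degree [n] and
    leaves the sum unchanged. The coefficient of [X^(n-1)] is also unchanged: in [P] it is minus the
    sum of the nodes, which is 0. *)
Lemma lagrange_sum0 f : \sum_i a i = 0 -> (size f <= n.+1)%N -> f`_n.-1 = 0 ->
  \sum_i f.[a i] / node_prod i = 0.
Proof.
move=> sum_a szf fn.
have [n0|n_gt0] := posnP n.
  by apply: big1 => i; have := ltn_ord i; rewrite [X in (_ < X)%N]n0.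
pose P : {poly F} := \prod_(x <- codom a) ('X - x%:P).
have szc : size (codom a) = n by rewrite size_codom card_ord.
have szP : size P = n.+1 by rewrite size_prod_XsubC szc.
have Pn : P`_n = 1.
  have /monicP := monic_prod_XsubC (codom a) xpredT id.
  by rewrite lead_coefE -/P szP.
have Pa i : P.[a i] = 0.
  by apply/eqP; rewrite -rootE root_prod_XsubC codom_f.
have Pn1 : P`_n.-1 = 0.
  rewrite -{1}szc coefPn_prod_XsubC ?szc -?lt0n //.
  by rewrite big_image /= sum_a oppr0.
pose g := f - f`_n *: P.
have -> : \sum_i f.[a i] / node_prod i = \sum_i g.[a i] / node_prod i.
  by apply: eq_bigr => i _; rewrite !hornerE Pa mulr0 subr0.
rewrite lagrange_lead ?coefB ?coefZ ?fn ?Pn1 ?mulr0 ?subrr //.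
apply/leq_sizeP => j; rewrite leq_eqVlt => /orP[/eqP<-|nj].
  by rewrite coefB coefZ Pn mulr1 subrr.
rewrite coefB coefZ [P`_j]nth_default ?szP // mulr0 subr0.
by rewrite nth_default // (leq_trans szf).
Qed.

End LagrangeSums.

(** * Polynomials whose evaluations form the code *)

Definition gap_poly (R : nzRingType) (k : nat) : pred {poly R} :=
  fun f => (size f <= k.+1)%N && (f`_k.-1 == 0).

Section GapPoly.
Variables (F : fieldType) (k : nat).
Hypothesis k_gt0 : (0 < k)%N.
Implicit Types f g : {poly F}.

Lemma gap_poly0 : gap_poly k (0 : {poly F}).
Proof. by rewrite /gap_poly size_poly0 coef0 eqxx. Qed.

Lemma gap_polyB f g : gap_poly k f -> gap_poly k g -> gap_poly k (f - g).
Proof.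
case/andP=> szf /eqP f0 /andP[szg /eqP g0].
rewrite /gap_poly coefB f0 g0 subrr eqxx andbT.
by rewrite (leq_trans (size_polyD _ _)) // geq_max size_polyN szf.
Qed.

Lemma gap_polyE f : gap_poly k f ->
  f = \sum_(j <- k :: iota 0 k.-1) f`_j *: 'X^j.
Proof.
case/andP=> szf /eqP f0.
have {1}-> : f = \sum_(0 <= j < k.+1) f`_j *: 'X^j.
  rewrite big_mkord -poly_def; apply/polyP => j; rewrite coef_poly.
  by case: ltnP => // kj; rewrite nth_default // (leq_trans szf).
case: k k_gt0 f0 szf => // m _ /= f0 szf.
rewrite big_nat_recr //= big_nat_recr //= f0 scale0r addr0 addrC.
by rewrite big_cons /index_iota subn0.
Qed.

Lemma gap_polyXn j : j \in k :: iota 0 k.-1 -> gap_poly k ('X^j : {poly F}).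
Proof.
rewrite inE mem_iota add0n leq0n /= /gap_poly size_polyXn coefXn ltnS.
case/predU1P => [->|jk]; first by rewrite leqnn ltn_eqF ?prednK ?eqxx.
by rewrite (leq_trans (ltnW jk) (leq_pred k)) gtn_eqF ?eqxx.
Qed.

Lemma gap_poly_sum (I : Type) (r : seq I) (c : I -> F) (f : I -> {poly F}) :
  (forall i, gap_poly k (f i)) -> gap_poly k (\sum_(i <- r) c i *: f i).
Proof.
move=> gapf; apply: (big_ind (gap_poly k)) => [|f1 f2 gap1 gap2|i _].
- exact: gap_poly0.
- rewrite -[f2]opprK; apply: gap_polyB => //.
  by rewrite -sub0r; apply: gap_polyB => //; apply: gap_poly0.
have /andP[szf /eqP f0] := gapf i.
by rewrite /gap_poly coefZ f0 mulr0 eqxx (leq_trans (size_scale_leq _ _)).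
Qed.

(** By Vieta, the coefficient of [X^(k-1)] is minus the sum of the roots. *)
Lemma gap_poly_prod (rs : seq F) : size rs = k -> \sum_(x <- rs) x = 0 ->
  gap_poly k (\prod_(x <- rs) ('X - x%:P)).
Proof.
move=> szrs sum0; rewrite /gap_poly size_prod_XsubC szrs leqnn -{1}szrs.
by rewrite coefPn_prod_XsubC ?szrs -?lt0n // sum0 oppr0 eqxx.
Qed.

(** The [k] distinct roots exhaust the degree, so [f] is a nonzero scalar times the product of its
    linear factors, and Vieta applies again. *)
Lemma gap_poly_roots f (rs : seq F) : gap_poly k f -> f != 0 -> uniq rs ->
  all (root f) rs -> size rs = k -> \sum_(x <- rs) x = 0.
Proof.
case/andP=> szf /eqP fk f0 urs rootf szrs.
have szfE : size f = (size rs).+1.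
  by apply/eqP; rewrite eqn_leq szrs szf -szrs max_poly_roots.
have urs' : uniq_roots rs by rewrite uniq_rootsE.
move: fk; rewrite (all_roots_prod_XsubC szfE rootf urs') coefZ -szrs.
rewrite coefPn_prod_XsubC ?szrs -?lt0n // => /eqP.
by rewrite mulf_eq0 lead_coef_eq0 (negPf f0) oppr_eq0 => /eqP.
Qed.

Lemma gap_polyM_coef f g : gap_poly k f -> gap_poly k g ->
  (size (f * g)%R <= (2 * k).+1)%N /\ (f * g)`_(2 * k).-1 = 0.
Proof.
case/andP=> szf /eqP f0 /andP[szg /eqP g0]; split.
  by move: (size_polyMleq f g) szf szg; move: (size _) (size _) (size _); lia.
rewrite coefM big1 // => -[j /= jk] _.
(* The indices in each term add up to [2k - 1]. Hence one of them exceeds [k], or they are [k] and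
   [k - 1], and the latter is the gap. *)
have [jk1|jk1|->] := ltngtP j k.-1; last by rewrite f0 mul0r.
  by rewrite [X in _ * X]nth_default ?mulr0 //; apply: leq_trans szg _; lia.
have [->|jk2] := eqVneq j k; last first.
  by rewrite nth_default ?mul0r //; apply: leq_trans szf _; lia.
have -> : ((2 * k).-1 - k = k.-1)%N by lia.
by rewrite g0 mulr0.
Qed.

End GapPoly.

(** * Dimension and minimum distance of the evaluation code *)

Section EvaluationCode.
Variables (F : finFieldType) (n k : nat) (a lam : 'I_n -> F).
Hypotheses (k_gt0 : (0 < k)%N) (k_lt_n : (k < n)%N).
Hypotheses (a_inj : injective a) (lam_neq0 : forall i, lam i != 0).
Implicit Types f g : {poly F}.

Definition ev f : 'rV[F]_n := \row_i (lam i * f.[a i]).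

Lemma evB f g : ev f - ev g = ev (f - g).
Proof. by apply/rowP => i; rewrite !mxE hornerD hornerN mulrBr. Qed.

Lemma ev_sum (I : Type) (r : seq I) (c : I -> F) (f : I -> {poly F}) :
  ev (\sum_(i <- r) c i *: f i) = \sum_(i <- r) c i *: ev (f i).
Proof.
apply/rowP => i; rewrite mxE horner_sum mulr_sumr summxE.
by apply: eq_bigr => j _; rewrite !mxE hornerZ mulrCA.
Qed.

Lemma ev_eq0 f : (size f <= n)%N -> ev f = 0 -> f = 0.
Proof.
move=> szf /rowP f0; apply: (poly_eq0_nodes a_inj szf) => i.
by have /eqP := f0 i; rewrite !mxE mulf_eq0 (negPf (lam_neq0 i)) => /eqP.
Qed.

Lemma code_genE :
  code_gen a k lam = <<[seq ev 'X^j | j <- k :: iota 0 k.-1]>>%VS.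
Proof.
congr <<_>>%VS; apply: eq_map => j.
by apply/rowP => i; rewrite !mxE hornerXn.
Qed.

Lemma mem_code_gen v :
  v \in code_gen a k lam <-> exists2 f, gap_poly k f & v = ev f.
Proof.
rewrite code_genE; set E := k :: _; set X := map _ _.
have nthX (i : 'I_(size X)) : X`_i = ev 'X^(nth 0%N E i).
  by rewrite (nth_map 0%N) // -(size_map (fun j => ev 'X^j)).
split=> [vX|[f gapf ->]].
  exists (\sum_i coord (in_tuple X) i v *: 'X^(nth 0%N E i)).
    apply: gap_poly_sum => // i; apply: gap_polyXn => //.
    by rewrite mem_nth // -(size_map (fun j => ev 'X^j)).
  rewrite ev_sum {1}(coord_span (X := in_tuple X) vX).
  by apply: eq_bigr => i _; rewrite nthX.
rewrite {1}(gap_polyE k_gt0 gapf) ev_sum big_seq.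
apply: memv_suml => j jE; apply/memvZ/memv_span.
by apply/mapP; exists j.
Qed.

(** A vanishing combination of the generators evaluates a polynomial of degree at most [k < n] to 0
    at all [n] nodes. That polynomial is therefore 0, and its coefficients at the distinct exponents
    in [E] are those of the combination. *)
Lemma dim_code_gen : \dim (code_gen a k lam) = k.
Proof.
rewrite code_genE; set E := k :: _; set X := map _ _.
have szX : size X = k by rewrite size_map /= size_iota prednK.
have szE : size E = k by rewrite /= size_iota prednK.
suff /eqnP : free X by rewrite szX.
have ltE (i : 'I_(size X)) : (i < size E)%N by rewrite szE -[X in (_ < X)%N]szX.
have nthX (i : 'I_(size X)) : X`_i = ev 'X^(nth 0%N E i).
  by rewrite (nth_map 0%N) ?ltE.
have gapX (i : 'I_(size X)) : gap_poly k ('X^(nth 0%N E i) : {poly F}).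
  by apply: gap_polyXn => //; rewrite mem_nth ?ltE.
have uE : uniq E.
  by rewrite /= iota_uniq andbT mem_iota add0n /= -leqNgt leq_pred.
apply/(freeP (X := in_tuple X)) => c.
under eq_bigr do rewrite nthX.
rewrite -ev_sum => /ev_eq0 c0 i.
have /andP[/leq_trans/(_ k_lt_n) szc _] := gap_poly_sum (index_enum _) c gapX.
have := congr1 (fun p : {poly F} => p`_(nth 0%N E i)) (c0 szc).
rewrite coef0 coef_sum (bigD1 i) //= coefZ coefXn eqxx mulr1.
rewrite big1 ?addr0 // => j ji.
rewrite coefZ coefXn nth_uniq ?ltE //.
by have /negPf := ji; rewrite eq_sym -val_eqE => /= ->; rewrite mulr0.
Qed.

Definition zeros f : {set 'I_n} := [set i | root f (a i)].

Lemma hamming_dist_ev f g :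
  hamming_dist (ev f) (ev g) = (n - #|zeros (f - g)|)%N.
Proof.
have := cardsC (zeros (f - g)); rewrite card_ord => cardC.
rewrite -[X in (X - _)%N]cardC addKn; apply: eq_card => i.
rewrite !inE !mxE rootE hornerD hornerN subr_eq0.
by rewrite (inj_eq (mulfI (lam_neq0 i))).
Qed.

Lemma zeros_uniq f : uniq [seq a i | i in zeros f].
Proof. by rewrite map_inj_uniq ?enum_uniq. Qed.

Lemma zeros_roots f : all (root f) [seq a i | i in zeros f].
Proof. by apply/allP => _ /imageP[i fi ->]; rewrite inE in fi. Qed.

Lemma card_zeros f : f != 0 -> (#|zeros f| < size f)%N.
Proof.
by move/max_poly_roots/(_ (zeros_roots f) (zeros_uniq f)); rewrite size_image.
Qed.

Lemma card_zeros_ge (rs : seq F) f : uniq rs -> {subset rs <= codom a} ->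
  all (root f) rs -> (size rs <= #|zeros f|)%N.
Proof.
move=> urs rsA /allP rootf; rewrite -(size_image a).
apply: uniq_leq_size => // x xrs.
have /codomP[i xE] := rsA x xrs; apply/imageP; exists i => //.
by rewrite inE -xE rootf.
Qed.

(** Two codewords agree exactly at the nodes where the difference of their polynomials vanishes, so
    the distance is governed by the largest number [z] of nodes that are roots of a nonzero
    admissible polynomial. *)
Lemma code_gen_linear_code z : (z <= n)%N ->
  (forall f, gap_poly k f -> f != 0 -> (#|zeros f| <= z)%N) ->
  (exists f, [/\ gap_poly k f, f != 0 & (z <= #|zeros f|)%N]) ->
  linear_code (code_gen a k lam) k (n - z).
Proof.
move=> zn zmax [f [gapf f0 zf]]; split; first exact: dim_code_gen.
split.
  exists (ev f), (ev 0); split.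
  - by apply/mem_code_gen; exists f.
  - by apply/mem_code_gen; exists 0; first exact: gap_poly0.
  - rewrite -subr_eq0 evB subr0; apply: contra_neq f0; apply: ev_eq0.
    by have /andP[/leq_trans->] := gapf.
  rewrite hamming_dist_ev subr0; congr (n - _)%N.
  by apply/eqP; rewrite eqn_leq zmax.
move=> _ _ /mem_code_gen[g gapg ->] /mem_code_gen[h gaph ->] gh.
rewrite hamming_dist_ev leq_sub2l // zmax ?gap_polyB //.
apply: contraNneq gh => gh0; rewrite -subr_eq0 evB gh0.
by apply/eqP/rowP => i; rewrite !mxE horner0 mulr0.
Qed.

(** The degree bounds the number of zeros by [k], and the monic polynomial with root set [S] attains
    it. *)
Lemma code_gen_linear_code_zero_sum (S : {set F}) :
  S \subset codom a -> #|S| = k -> zero_sum S ->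
  linear_code (code_gen a k lam) k (n - k).
Proof.
move=> SA cS sS; apply: code_gen_linear_code => [|f /andP[szf _] f0|].
- exact: ltnW.
- by rewrite -ltnS (leq_trans (card_zeros f0)).
have szS : size (enum S) = k by rewrite -cardE.
exists (\prod_(x <- enum S) ('X - x%:P)); split.
- by apply: gap_poly_prod; rewrite // big_enum.
- by rewrite monic_neq0 // monic_prod_XsubC.
- rewrite -szS; apply: card_zeros_ge; first exact: enum_uniq.
    by move=> x; rewrite mem_enum => /(subsetP SA).
  by apply/allP => x xS; rewrite root_prod_XsubC.
Qed.

(** A nonzero admissible polynomial with [k] zeros among the nodes would expose a zero-sum subset of
    size [k], so at most [k - 1] zeros occur. *)
Lemma code_gen_linear_code_zero_sum_free :
  zero_sum_free k [set a i | i : 'I_n] ->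
  linear_code (code_gen a k lam) k (n - k.-1).
Proof.
move=> zsf; apply: code_gen_linear_code => [|f gapf f0|].
- by rewrite (leq_trans (leq_pred k)) // ltnW.
- rewrite -ltnS prednK // ltn_neqAle; apply/andP; split; last first.
    by have /andP[szf _] := gapf; rewrite -ltnS (leq_trans (card_zeros f0)).
  apply/eqP => zk; apply: (zsf (a @: zeros f)).
  + by apply/subsetP => _ /imsetP[i _ ->]; rewrite imset_f.
  + by rewrite card_imset.
  have := gap_poly_roots k_gt0 gapf f0 (zeros_uniq f) (zeros_roots f).
  rewrite size_image => /(_ zk); rewrite big_image /= => sum0.
  by rewrite /zero_sum big_imset //= => i j _ _ /a_inj.
(* Besides k - 1 arbitrary nodes, take the root that makes the sum vanish. *)
pose T := take k.-1 (codom a).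
have szT : size T = k.-1.
  by rewrite size_takel // size_codom card_ord (leq_trans (leq_pred k)) // ltnW.
pose rs := - (\sum_(x <- T) x) :: T.
exists (\prod_(x <- rs) ('X - x%:P)); split.
- apply: gap_poly_prod; rewrite ?big_cons ?addNr //.
  by rewrite /= szT prednK.
- by rewrite monic_neq0 // monic_prod_XsubC.
(* Only the roots in [T] are counted: the added root may lie outside the nodes or repeat an element
   of [T]. *)
- rewrite -szT; apply: card_zeros_ge.
  + by rewrite take_uniq //; apply/injectiveP.
  + exact: mem_take.
  by apply/allP => x xT; rewrite root_prod_XsubC inE xT orbT.
Qed.

End EvaluationCode.

Theorem lemma3p2 (F : finFieldType) (k : nat) (k_gt0 : (0 < k)%N)
    (A : {set F}) (a : 'I_(2 * k) -> F) (a_inj : injective a)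
    (A_def : A = [set a i | i : 'I_(2 * k)])
    (sum_a : \sum_(i < 2 * k) a i = 0)
    (quad_pi : forall x y : F, x \in A -> y \in A ->
       quad_char (pi_set A x) = quad_char (pi_set A y)) :
  (zero_sum_free k A ->
     exists lambda : 'I_(2 * k) -> F,
       [/\ forall i, lambda i != 0,
           MDS (code_gen a k lambda) & self_dual (code_gen a k lambda)]) /\
  ((exists S : {set F}, [/\ S \subset A, #|S| = k & zero_sum S]) ->
     exists lambda : 'I_(2 * k) -> F,
       [/\ forall i, lambda i != 0,
           NMDS (code_gen a k lambda) & self_dual (code_gen a k lambda)]).
Proof.
have k_lt : (k < 2 * k)%N by rewrite mul2n -addnn -{1}[k]addn0 ltn_add2l.
have piE i : pi_set A (a i) = node_prod a i.
  rewrite /pi_set A_def big_imset_cond /=; last by move=> ? ? _ _ /a_inj.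
  by apply: eq_bigl => j; rewrite (inj_eq a_inj).
have aA i : a i \in A by rewrite A_def imset_f.
(* The common constant is the product at the node of index 0; any other node would serve, as all
   these products share one square class. *)
pose c := node_prod a (Ordinal (leq_ltn_trans (leq0n k) k_lt)).
have c0 : c != 0 by exact: node_prod_neq0.
have sqr i : exists l, l ^+ 2 = c / node_prod a i.
  apply: quad_char_eq_div_sqr; rewrite ?node_prod_neq0 //.
  by rewrite /c -!piE; apply: quad_pi.
have [lam lam2] := fin_all_exists sqr.
have lam0 i : lam i != 0.
  have := lam2 i; apply: contra_eqN => /eqP->; rewrite expr0n eq_sym.
  by rewrite mulf_neq0 // invr_eq0 node_prod_neq0.
have sd : self_dual (code_gen a k lam).
  apply: self_dual_half; first by rewrite dim_code_gen // mul2n.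
  apply/subvP => v /mem_code_gen[//|f gapf ->]; apply/dual_codeP => u.
  case/mem_code_gen=> // g gapg ->.
  have [szgf gf0] := gap_polyM_coef k_gt0 gapg gapf.
  (* The factor [c] turns the weights [1 / node_prod a i] into [lam i ^+ 2], so the sum becomes the
     inner product of two codewords. *)
  have /(congr1 ( *%R c)) := lagrange_sum0 a_inj sum_a szgf gf0.
  rewrite mulr0 mulr_sumr => sum0; rewrite -[RHS]sum0.
  apply: eq_bigr => i _; rewrite !mxE mulrACA -expr2 lam2 hornerM.
  by rewrite -mulrA [_^-1 * _]mulrC.
split=> [zsf|[S [SA cS sS]]]; exists lam; split=> //.
  exists k, (2 * k - k.-1)%N; split; last by lia.
  by apply: code_gen_linear_code_zero_sum_free => //; rewrite -A_def.
have amds : AMDS (code_gen a k lam).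
  exists k, (2 * k - k)%N; split=> //.
  apply: (code_gen_linear_code_zero_sum k_gt0 k_lt a_inj lam0 _ cS sS).
  apply/subsetP => x /(subsetP SA); rewrite A_def => /imsetP[i _ ->].
  exact: codom_f.
(* Self-duality transfers the AMDS property to the dual. *)
by split=> //; rewrite -sd.
Qed.
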